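(* Let $w>0$, $\kappa>1$, $\Delta>0$ be fixed. For all $\tau_1$ sufficiently large depending only on $w$, $\kappa$ and $\Delta$, the number $$\tau_0=\tau_1+w-\frac{\delta}{\kappa-1},\qquad \delta=\psi\left(\frac1{\kappa-1}\,\psi\left(\frac1{\kappa-1}\,\psi(\tau_1)\right)-w\right),\qquad \psi(t)=\kappa t-\sqrt{t^2+\Delta^2},$$ satisfies $$\tau_1\ge\max\left\{\kappa\tau_0,\ \tau_0+\frac{\kappa\Delta}{\kappa-1}\right\},$$ and the following holds. Let $\Omega\subset\mathbb R^n$ be a bounded convex domain and let $\Sigma=\{Y_1,\dots,Y_N\}$ be a target of distinct points contained in the slab $\{(y,y_{n+1})\in\mathbb R^{n+1}:\tau_1\le y_{n+1}\le\tau_1+w\}$, with $\max_{1\le i\le N}\mathrm{diam}(\Omega\cup\{y_i\})=\Delta$ where $Y_i=(y_i,y^i_{n+1})$, satisfying the visibility condition: for all $X\in\Omega\times[0,\tau_0]$ and all $m\in S^n$, the ray $\{X+tm:t>0\}$ intersects $\Sigma$ in at most one point. Let $f\in L^1(\Omega)$ be nonnegative and let $\mu=\sum_{i=1}^Na_i\delta_{Y_i}$ with $a_i>0$ and $\int_\Omega f(x)\,dx=\sum_{i=1}^Na_i$. Then there is a parallel refractor $u:\Omega\to[0,\tau_0]$ from $\Omega$ to $\Sigma$ satisfying $$\int_{\mathcal T_u(E)}f(x)\,dx=\mu(E)\qquad\text{for all }E\subset\Sigma.$$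
   Context: Points of $\mathbb R^{n+1}$ are written $X=(x,x_{n+1})$, $Y=(y,y_{n+1})$. For $Y\in\mathbb R^{n+1}$ and $b>0$, $$\phi_{Y,b}(x)=y_{n+1}-\frac{\kappa b}{\kappa^2-1}-\sqrt{\frac{b^2}{(\kappa^2-1)^2}+\frac{|x-y|^2}{\kappa^2-1}},\qquad x\in\mathbb R^n,$$ whose graph is the lower sheet $\mathcal H(Y,b)$ of a two-sheeted hyperboloid with upper focus $Y$ and eccentricity $\kappa$. A function $u:\Omega\to(0,+\infty)$ is a (parallel) refractor from $\Omega$ to $\Sigma$ if for each $x_0\in\Omega$ there exist $Y=(y,y_{n+1})\in\Sigma$ and $0<b<\kappa y_{n+1}-\sqrt{y_{n+1}^2+\Delta^2}$ such that $u(x)\ge\phi_{Y,b}(x)$ for all $x\in\Omega$, with equality at $x=x_0$ (here it is required that $y_{n+1}>\Delta/\sqrt{\kappa^2-1}$ for all $Y\in\Sigma$, which holds for $\tau_1$ large). For a refractor $u$ and $Y\in\Sigma$, the tracing mapping is $$\mathcal T_u(Y)=\{x_0\in\Omega:\ \exists\,b>0\text{ with }u\ge\phi_{Y,b}\text{ in }\Omega\text{ and }u(x_0)=\phi_{Y,b}(x_0)\},$$ and $\mathcal T_u(E)=\bigcup_{Y\in E}\mathcal T_u(Y)$ for $E\subset\Sigma$. *)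

(* Defs.v *)
From HB Require Import structures.
From mathcomp Require Export all_boot all_order all_algebra.
From mathcomp Require Export all_classical all_reals all_analysis.

Set Implicit Arguments.
Unset Strict Implicit.
Unset Printing Implicit Defensive.

Import Order.TTheory GRing.Theory Num.Theory.
Import numFieldNormedType.Exports.

Local Open Scope classical_set_scope.
Local Open Scope ring_scope.

(* The library has no Lebesgue measure on R^n.  It is built here in two steps:
   the iterated product of the one-dimensional Lebesgue measure on the Borel
   sigma-algebra of 'rV[R]_n (generated by the coordinate projections), then
   its Caratheodory completion, so that "measurable" below means
   Lebesgue measurable. *)
Definition row_display : measure_display.
Proof. exact: default_measure_display. Qed.

Section measurable_row.
Context (R : realType) (n : nat).

Let coord (i : 'I_n) (v : 'rV[R]_n) : R := v ord0 i.

Let row_set0 : g_sigma_preimage coord set0.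
Proof. exact: sigma_algebra0. Qed.

Let row_setC A : g_sigma_preimage coord A -> g_sigma_preimage coord (~` A).
Proof. exact: sigma_algebraC. Qed.

Let row_bigcup (F : _^nat) : (forall i, g_sigma_preimage coord (F i)) ->
  g_sigma_preimage coord (\bigcup_i (F i)).
Proof. exact: sigma_algebra_bigcup. Qed.

HB.instance Definition _ := @isMeasurable.Build row_display
  'rV[R]_n (g_sigma_preimage coord) row_set0 row_setC row_bigcup.

Lemma measurable_coord (i : 'I_n) :
  measurable_fun [set: 'rV[R]_n] (fun v : 'rV[R]_n => v ord0 i).
Proof.
move=> _ Y mY; rewrite setTI; apply: sub_sigma_algebra => /=.
rewrite -bigcup_seq/=; exists i => /=; first by rewrite mem_index_enum.
by exists Y => //; rewrite setTI.
Qed.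

Lemma measurable_fun_row d (T : measurableType d) (f : T -> 'rV[R]_n) :
  (forall i, measurable_fun [set: T] (fun x => f x ord0 i)) ->
  measurable_fun [set: T] f.
Proof.
move=> mf; have sub : g_sigma_preimage (fun i => coord i \o f) `<=` measurable.
  apply: smallest_sub; first exact: sigma_algebra_measurable.
  rewrite -bigcup_seq/=; apply: bigcup_sub => i _ A [B mB <-].
  exact: mf.
by move: sub; rewrite g_sigma_preimage_comp => sub _ A mA; apply: sub; exists A.
Qed.

End measurable_row.

Section lebesgue_row.
Context (R : realType).

Definition row_cons n (p : R * 'rV[R]_n) : 'rV[R]_n.+1 := row_mx p.1%:M p.2.

Definition row_uncons n (v : 'rV[R]_n.+1) : R * 'rV[R]_n :=
  (v ord0 ord0, @rsubmx R 1 1 n v).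

Lemma row_cons_head n (p : R * 'rV[R]_n) : row_cons p ord0 ord0 = p.1.
Proof.
transitivity (row_mx p.1%:M p.2 ord0 (lshift n ord0)).
  by congr (_ _ _); exact/val_inj.
by rewrite row_mxEl mxE eqxx.
Qed.

Lemma row_cons_tail n (p : R * 'rV[R]_n) i :
  row_cons p ord0 (lift ord0 i) = p.2 ord0 i.
Proof.
transitivity (row_mx p.1%:M p.2 ord0 (rshift 1 i)).
  by congr (_ _ _); exact/val_inj.
exact: row_mxEr.
Qed.

Lemma row_consK n : cancel (@row_cons n) (@row_uncons n).
Proof.
move=> [x v]; rewrite /row_uncons row_cons_head /row_cons /=; congr pair.
exact: row_mxKr.
Qed.

Lemma measurable_row_cons n : measurable_fun [set: R * 'rV[R]_n] (@row_cons n).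
Proof.
apply: measurable_fun_row => i; case: (unliftP ord0 i) => [j|] ->.
  apply: (eq_measurable_fun ((fun v : 'rV[R]_n => v ord0 j) \o snd)) => [p _|].
    by rewrite row_cons_tail.
  by apply: measurableT_comp; [exact: measurable_coord|exact: measurable_snd].
apply: (eq_measurable_fun fst) => [p _|]; last exact: measurable_fst.
by rewrite row_cons_head.
Qed.

Lemma measurable_row_uncons n :
  measurable_fun [set: 'rV[R]_n.+1] (@row_uncons n).
Proof.
apply/measurable_fun_pairP; split; first exact: measurable_coord.
apply: measurable_fun_row => j.
apply: (eq_measurable_fun (fun v : 'rV[R]_n.+1 => v ord0 (rshift 1 j))).
  by move=> v _; rewrite /= mxE.
exact: measurable_coord.
Qed.

Section step.
Context n (mu : {sigma_finite_measure set 'rV[R]_n -> \bar R}).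

Definition lebesgue_row_step : set 'rV[R]_n.+1 -> \bar R :=
  pushforward (lebesgue_measure \x mu)%E (@row_cons n).

Let mrow_cons := @measurable_row_cons n.

Let lebesgue_row_step0 : lebesgue_row_step set0 = 0%E.
Proof. by rewrite /lebesgue_row_step /pushforward preimage_set0 measure0. Qed.

Let lebesgue_row_step_ge0 A : (0 <= lebesgue_row_step A)%E.
Proof. exact: measure_ge0. Qed.

Let lebesgue_row_step_sigma_additive : semi_sigma_additive lebesgue_row_step.
Proof. exact: measure_semi_sigma_additive. Qed.

HB.instance Definition _ := isMeasure.Build _ _ _ lebesgue_row_step
  lebesgue_row_step0 lebesgue_row_step_ge0 lebesgue_row_step_sigma_additive.

Let lebesgue_row_step_sigma_finite : sigma_finite setT lebesgue_row_step.
Proof.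
have /sigma_finiteP[F [TF ndF Foo]] := sigma_finiteT (@lebesgue_measure R).
have /sigma_finiteP[G [TG ndG Goo]] := sigma_finiteT mu.
exists (fun k => @row_uncons n @^-1` (F k `*` G k)).
  rewrite -preimage_bigcup (_ : \bigcup_i _ = setT) ?preimage_setT//.
  rewrite -subTset => -[x v] _.
  have [i _ Fix] : (\bigcup_i F i) x by rewrite -TF.
  have [j _ Gjv] : (\bigcup_i G i) v by rewrite -TG.
  exists (maxn i j) => //; split.
    by move: x Fix; exact/subsetPset/ndF/leq_maxl.
  by move: v Gjv; exact/subsetPset/ndG/leq_maxr.
move=> k; have [mF Fk] := Foo k; have [mG Gk] := Goo k; split.
  rewrite -[X in measurable X]setTI; apply: measurable_row_uncons => //.
  exact: measurableX.
rewrite /lebesgue_row_step /pushforward -comp_preimage.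
rewrite (_ : _ \o _ = id); last by apply/funext => p /=; rewrite row_consK.
rewrite preimage_id product_measure1E//.
by rewrite lte_mul_pinfty// ge0_fin_numE.
Qed.

HB.instance Definition _ := Measure_isSigmaFinite.Build _ _ _
  lebesgue_row_step lebesgue_row_step_sigma_finite.

End step.

Fixpoint lebesgue_row_borel n :
    {sigma_finite_measure set 'rV[R]_n -> \bar R} :=
  match n with
  | 0 => [the {sigma_finite_measure set 'rV[R]_0 -> \bar R} of \d_(0 : 'rV[R]_0)]
  | n'.+1 => lebesgue_row_step (lebesgue_row_borel n')
  end.

Definition lebesgue_row n :=
  @completed_measure_extension _ _ _ (lebesgue_row_borel n).

HB.instance Definition _ n := Measure.on (@lebesgue_row n).

End lebesgue_row.
Arguments lebesgue_row R n : clear implicits.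

Definition lebesgue_measurable (R : realType) n (A : set 'rV[R]_n) :=
  measurable (A : set (caratheodory_type (lebesgue_row_borel R n)^*%mu)).

Section lebesgue_box.
Context (R : realType).

Lemma lebesgue_row_borelE n (A : set 'rV[R]_n) :
  measurable A -> lebesgue_row R n A = lebesgue_row_borel R n A.
Proof. exact: measurable_mu_extE. Qed.

Let measurable_box n (I : 'I_n -> set R) : (forall i, measurable (I i)) ->
  measurable [set v : 'rV[R]_n | forall i, I i (v ord0 i)].
Proof.
move=> mI; rewrite (_ : [set v | _] =
    \bigcap_(i in [set: 'I_n]) (fun v : 'rV[R]_n => v ord0 i) @^-1` I i).
  apply: fin_bigcap_measurable => // i _.
  by rewrite -[X in measurable X]setTI; exact: measurable_coord.
by apply/seteqP; split=> v /= h i => [_|]; exact: h.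
Qed.

Lemma lebesgue_row_box n (I : 'I_n -> set R) : (forall i, measurable (I i)) ->
  lebesgue_row R n [set v : 'rV[R]_n | forall i, I i (v ord0 i)] =
  (\prod_(i < n) lebesgue_measure (I i : set (measurableTypeR R)))%E.
Proof.
move=> mI; rewrite lebesgue_row_borelE; last exact: measurable_box.
elim: n I mI => [|n IHn] I mI /=.
  rewrite big_ord0 diracE (_ : _ \in _ = true)//.
  by apply/mem_set => -[].
rewrite /lebesgue_row_step /pushforward big_ord_recl -IHn//.
rewrite -(product_measure1E
  (lebesgue_measure : {measure set (measurableTypeR R) -> \bar R})
  (lebesgue_row_borel R n) (mI ord0)
  (measurable_box (fun i => mI (lift ord0 i)))).
congr product_measure1; apply/seteqP; split=> -[x v] /=.
  move=> h; split=> [|i]; first by have := h ord0; rewrite row_cons_head.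
  by have := h (lift ord0 i); rewrite row_cons_tail.
move=> [Ix Iv] i; case: (unliftP ord0 i) => [j|] ->.
  by rewrite row_cons_tail.
by rewrite row_cons_head.
Qed.

End lebesgue_box.

Section geometry.
Context (R : realType) (n : nat).
Implicit Types (x y : 'rV[R]_n) (X m : 'rV[R]_n * R) (A : set 'rV[R]_n).

(* The library norm on 'rV[R]_n is the sup norm. *)
Definition enorm x : R := Num.sqrt (\sum_i (x ord0 i) ^+ 2).

Definition diam A : R := sup [set enorm (x - y) | x in A & y in A].

Definition bounded_convex_domain A :=
  [/\ A !=set0, open A, bounded_set A &
      convex_set (A : set (convex_lmodType 'rV[R]_n))].

(* Points of R^(n+1) are pairs X = (X.1, X.2) of 'rV[R]_n * R. *)
Definition unit_sphere : set ('rV[R]_n * R) :=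
  [set m | enorm m.1 ^+ 2 + m.2 ^+ 2 = 1].

Definition ray X m : set ('rV[R]_n * R) :=
  [set (X.1 + t *: m.1, X.2 + t * m.2) | t in [set t : R | 0 < t]].

Definition visible A (tau : R) (Sigma : set ('rV[R]_n * R)) :=
  forall X m, (A `*` `[0, tau]) X -> unit_sphere m ->
    is_subset1 (ray X m `&` Sigma).

End geometry.

Section refractor.
Context (R : realType) (kappa Delta : R).

Definition psi (t : R) : R := kappa * t - Num.sqrt (t ^+ 2 + Delta ^+ 2).

Definition tau0 (w tau1 : R) : R :=
  let delta := psi ((kappa - 1)^-1 * psi ((kappa - 1)^-1 * psi tau1) - w) in
  tau1 + w - delta / (kappa - 1).

Context (n : nat).
Implicit Types (x : 'rV[R]_n) (Y : 'rV[R]_n * R) (b : R).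

Definition phi Y b x : R :=
  Y.2 - kappa * b / (kappa ^+ 2 - 1)
  - Num.sqrt (b ^+ 2 / (kappa ^+ 2 - 1) ^+ 2
              + enorm (x - Y.1) ^+ 2 / (kappa ^+ 2 - 1)).

Context (Omega : set 'rV[R]_n).
Implicit Types (Sigma E : set ('rV[R]_n * R)) (u : 'rV[R]_n -> R).

(* Only the values of u on Omega matter. *)
Definition is_refractor Sigma u :=
  [/\ forall Y, Sigma Y -> Delta / Num.sqrt (kappa ^+ 2 - 1) < Y.2,
      forall x, Omega x -> 0 < u x &
      forall x0, Omega x0 -> exists Y b,
        [/\ Sigma Y,
            0 < b < kappa * Y.2 - Num.sqrt (Y.2 ^+ 2 + Delta ^+ 2),
            forall x, Omega x -> phi Y b x <= u x &
            u x0 = phi Y b x0]].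

Definition tracing u Y : set 'rV[R]_n :=
  [set x0 | Omega x0 /\ exists b,
    [/\ 0 < b, forall x, Omega x -> phi Y b x <= u x & u x0 = phi Y b x0]].

Definition tracing_set u E : set 'rV[R]_n := \bigcup_(Y in E) tracing u Y.

End refractor.

(* Main.v *)
From HB Require Import structures.
Require Import Defs.
From mathcomp Require Import ring lra measurable_realfun.

(** The refractor is an envelope [u = max_i phi_(Y_i, b_i)], and the problem is
    to choose the [b_i] so that the cell of [Y_i], where [phi_(Y_i, b_i)]
    attains the maximum, has mass [a_i].  Fix [b_o] for one index [o]; among the
    [b >= lo] whose cells carry mass at most [a_i] for all [i != o], take the
    coordinatewise infimum.  Lowering [b_k] enlarges the cell of [Y_k] and
    shrinks all others, so the infimum is still admissible, and a deficit of mass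
    in the cell of some [k != o] would allow lowering [b_k] further; the cell of
    [o] then gets the remaining mass.  The nested [psi] in [tau0] give
    [delta <= b_i < psi (Y_i).2]: with [b_o = psi (psi tau1 / (kappa - 1))] the
    sheet of [Y_o] stays above [(Y_o).2 - psi tau1 / (kappa - 1)] over [Omega],
    which bounds [b_i] from above wherever [Y_i] is active, and a [b_i < delta]
    would put the sheet of [Y_i] above that of [Y_o] everywhere.

    Two sheets with distinct foci coincide on a null set because every line in a
    suitable coordinate direction meets the coincidence set in finitely many
    points.  As every cell has positive mass, each [phi_(Y_i, b_i)] touches [u],
    so the tracing map of [Y_i] is exactly its cell. *)

Import Order.TTheory GRing.Theory Num.Theory.
Import numFieldNormedType.Exports.

Local Open Scope classical_set_scope.
Local Open Scope ring_scope.

(** * Bounds on [psi] and [phi] *)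

Section psi_bounds.
Context {R : realType} (kappa Delta : R).
Implicit Types s t : R.

(** After squaring, only [t * (s - t) <= Num.sqrt (t ^+ 2 + e) * |s - t|] remains, which holds
    because the root dominates [|t|]. *)
Lemma sqrt_sqrD_lip s t (e : R) : 0 <= e ->
  Num.sqrt (s ^+ 2 + e) <= Num.sqrt (t ^+ 2 + e) + `|s - t|.
Proof.
move=> e0; have se u : 0 <= u ^+ 2 + e by rewrite addr_ge0// sqr_ge0.
rewrite -[leRHS]ger0_norm ?addr_ge0// -sqrtr_sqr ler_sqrt ?sqr_ge0//.
rewrite sqrrD sqr_sqrtr// real_normK ?num_real//.
have : t * (s - t) <= Num.sqrt (t ^+ 2 + e) * `|s - t|.
  rewrite (le_trans (ler_norm _))// normrM ler_wpM2r//.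
  by rewrite -sqrtr_sqr ler_sqrt// lerDl.
rewrite mulr2n; lra.
Qed.

Lemma psi_lt t : 0 < Delta -> psi kappa Delta t < (kappa - 1) * t.
Proof.
move=> D0; suff : t < Num.sqrt (t ^+ 2 + Delta ^+ 2) by rewrite /psi; lra.
rewrite (le_lt_trans (ler_norm _))// -sqrtr_sqr ltr_sqrt ?ltrDl ?exprn_gt0//.
by rewrite ltr_wpDl ?sqr_ge0 ?exprn_gt0.
Qed.

Lemma psi_ge t : 0 <= Delta -> 0 <= t ->
  (kappa - 1) * t - Delta <= psi kappa Delta t.
Proof.
move=> D0 t0; suff : Num.sqrt (t ^+ 2 + Delta ^+ 2) <= t + Delta by rewrite /psi; lra.
rewrite -[leRHS]ger0_norm ?addr_ge0// -sqrtr_sqr ler_sqrt ?sqr_ge0//.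
by rewrite sqrrD -addrA lerD2l lerDr mulrn_wge0// mulr_ge0.
Qed.

Lemma psi_sub s t : s <= t ->
  (kappa - 1) * (t - s) + psi kappa Delta s <= psi kappa Delta t.
Proof.
move=> st; have := sqrt_sqrD_lip t s _ (sqr_ge0 Delta).
rewrite ger0_norm ?subr_ge0// /psi; lra.
Qed.

End psi_bounds.

Section phi_bounds.
Context {R : realType} (kappa Delta : R).
Hypothesis kappa_gt1 : 1 < kappa.
Context {n : nat}.
Implicit Types (x : 'rV[R]_n) (Y : 'rV[R]_n * R) (b c s : R).

Let q_gt0 : 0 < kappa ^+ 2 - 1.
Proof. by rewrite subr_gt0 exprn_egt1. Qed.

Let qE : kappa ^+ 2 - 1 = (kappa - 1) * (kappa + 1).
Proof. ring. Qed.

Let k1_gt0 : 0 < kappa - 1. Proof. by rewrite subr_gt0. Qed.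

Let k2_gt0 : 0 < kappa + 1.
Proof. by rewrite addr_gt0 ?ltr01 ?(lt_trans ltr01 kappa_gt1). Qed.

Let phiE Y b x : phi kappa Y b x = Y.2 - kappa * (b / (kappa ^+ 2 - 1)) -
  Num.sqrt ((b / (kappa ^+ 2 - 1)) ^+ 2 + enorm (x - Y.1) ^+ 2 / (kappa ^+ 2 - 1)).
Proof. by rewrite /phi expr_div_n mulrA. Qed.

Let e_ge0 Y x : 0 <= enorm (x - Y.1) ^+ 2 / (kappa ^+ 2 - 1).
Proof. by rewrite mulr_ge0 ?sqr_ge0 ?invr_ge0 ?ltW. Qed.

(** In the variable [b / (kappa ^+ 2 - 1)] the linear term falls at rate [kappa > 1], while the root
    varies at rate at most 1. *)
Lemma phi_anti Y b c x : b < c -> phi kappa Y c x < phi kappa Y b x.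
Proof.
move=> bc; rewrite !phiE.
have bc' : b / (kappa ^+ 2 - 1) < c / (kappa ^+ 2 - 1).
  by rewrite ltr_pM2r ?invr_gt0.
have := sqrt_sqrD_lip (b / (kappa ^+ 2 - 1)) (c / (kappa ^+ 2 - 1)) _ (e_ge0 Y x).
rewrite ler0_norm ?subr_le0 ?(ltW bc')//.
have : 0 < (kappa - 1) * (c / (kappa ^+ 2 - 1) - b / (kappa ^+ 2 - 1)).
  by rewrite mulr_gt0 ?subr_gt0.
lra.
Qed.

(** In the rescaled variable the two rates add up to at most [kappa + 1], and [(kappa + 1) / (kappa
    ^+ 2 - 1) = (kappa - 1)^-1]. *)
Lemma phi_lip Y b c x : b <= c ->
  phi kappa Y b x <= phi kappa Y c x + (kappa - 1)^-1 * (c - b).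
Proof.
move=> bc; rewrite !phiE.
have bc' : b / (kappa ^+ 2 - 1) <= c / (kappa ^+ 2 - 1).
  by rewrite ler_pM2r ?invr_gt0.
have := sqrt_sqrD_lip (c / (kappa ^+ 2 - 1)) (b / (kappa ^+ 2 - 1)) _ (e_ge0 Y x).
rewrite ger0_norm ?subr_ge0//.
have -> : (kappa - 1)^-1 * (c - b) =
    (kappa + 1) * (c / (kappa ^+ 2 - 1) - b / (kappa ^+ 2 - 1)).
  by rewrite qE; field; rewrite !gt_eqF.
lra.
Qed.

Let topE Y b : Y.2 - b / (kappa - 1) =
  Y.2 - kappa * (b / (kappa ^+ 2 - 1)) - b / (kappa ^+ 2 - 1).
Proof. by rewrite qE; field; rewrite !gt_eqF. Qed.

(** The bound is the height of the vertex of the sheet, obtained by dropping the distance term. *)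
Lemma phi_le_top Y b x : phi kappa Y b x <= Y.2 - b / (kappa - 1).
Proof.
rewrite phiE topE lerD2l lerN2 (le_trans (ler_norm _))// -sqrtr_sqr.
by rewrite ler_sqrt ?lerDl// addr_ge0// sqr_ge0.
Qed.

Lemma phi_lt_top Y b x : enorm (x - Y.1) != 0 ->
  phi kappa Y b x < Y.2 - b / (kappa - 1).
Proof.
move=> xY; have e0 : 0 < enorm (x - Y.1) ^+ 2 / (kappa ^+ 2 - 1).
  by rewrite divr_gt0// exprn_even_gt0.
rewrite phiE topE ltrD2l ltrN2 (le_lt_trans (ler_norm _))// -sqrtr_sqr.
by rewrite ltr_sqrt ?ltrDl// ltr_wpDl// sqr_ge0.
Qed.

(* [b = psi s] makes the sheet of [phi] meet the height [Y.2 - s] exactly at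
   the distance [Delta] from the axis. *)
Lemma phi_psi_ge Y s x : enorm (x - Y.1) <= Delta ->
  Y.2 - s <= phi kappa Y (psi kappa Delta s) x.
Proof.
move=> xD; rewrite phiE; set q := kappa ^+ 2 - 1; set b := psi _ _ _.
have d0 : 0 <= enorm (x - Y.1) by exact: sqrtr_ge0.
pose r := Num.sqrt (s ^+ 2 + Delta ^+ 2).
have r2 : r ^+ 2 = s ^+ 2 + Delta ^+ 2 by rewrite sqr_sqrtr ?addr_ge0 ?sqr_ge0.
have sr : s <= r.
  rewrite (le_trans (ler_norm _))// -sqrtr_sqr ler_sqrt ?lerDl ?sqr_ge0//.
  by rewrite addr_ge0 ?sqr_ge0.
have r0 : 0 <= r by exact: sqrtr_ge0.
have kr : 0 <= kappa * r - s.
  by have : 0 <= (kappa - 1) * r by [rewrite mulr_ge0// ltW]; lra.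
have bE : b = kappa * s - r by [].
have sE : s - kappa * (b / q) = (kappa * r - s) / q.
  by rewrite bE /q; field; rewrite gt_eqF.
suff : Num.sqrt ((b / q) ^+ 2 + enorm (x - Y.1) ^+ 2 / q) <= (kappa * r - s) / q.
  lra.
rewrite -(ger0_norm (divr_ge0 kr (ltW q_gt0))) -sqrtr_sqr ler_sqrt ?sqr_ge0//.
have -> : ((kappa * r - s) / q) ^+ 2 = (b / q) ^+ 2 + (r ^+ 2 - s ^+ 2) / q.
  by rewrite bE /q; field; rewrite gt_eqF.
rewrite r2 [s ^+ 2 + _]addrC addrK lerD2l ler_pM2r ?invr_gt0//.
by rewrite ler_pXn2r// ?nnegrE// (le_trans d0).
Qed.

Lemma phi_gt Y b s x : enorm (x - Y.1) <= Delta -> b < psi kappa Delta s ->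
  Y.2 - s < phi kappa Y b x.
Proof.
move=> xD bs.
exact: le_lt_trans (phi_psi_ge _ s _ xD) (phi_anti _ _ _ _ bs).
Qed.

End phi_bounds.

(** * Null sets in the space of row vectors *)

Section row_measurability.
Context {R : realType}.

(** Rational centres and radii [1 / (m + 1)] give countably many cubes; [A] is the union of those it
    contains. *)
Lemma open_measurable_row n (A : set 'rV[R]_n) : open A -> measurable A.
Proof.
move=> oA; pose box (p : 'rV[rat]_n * nat) : set 'rV[R]_n :=
  [set v | forall i, `|ratr (p.1 ord0 i) - v ord0 i| < p.2.+1%:R^-1].
have mbox p : measurable (box p).
  rewrite (_ : box p = \bigcap_(i in [set: 'I_n]) (fun v : 'rV[R]_n => v ord0 i) @^-1`
      (ball (ratr (p.1 ord0 i) : R) (p.2.+1%:R^-1))).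
    apply: fin_bigcap_measurable => // i _.
    rewrite -[X in measurable X]setTI; apply: measurable_coord => //.
    by apply: open_measurable; apply: ball_open; rewrite invr_gt0.
  by apply/seteqP; split=> v /= h i; [move=> _|]; exact: h.
rewrite (_ : A = \bigcup_p (if `[< box p `<=` A >] then box p else set0)).
  apply: countable_bigcupT_measurable => [|p]; first exact: countableP.
  by case: ifP.
apply/seteqP; split=> x; last by move=> [p _]; case: asboolP => // bA; exact: bA.
move=> Ax; have /nbhs_ballP[e /= e0 eA] : nbhs x A by exact: open_nbhs_nbhs.
(* Half the radius, because a point of the cube reaches [x] through the centre in two steps. *)
have e20 : 0 < e / 2 by rewrite divr_gt0.
have [m hm] := filter_ex (near_infty_natSinv_lt (PosNum e20)).
have /choice[q hq] i : exists q : rat, `|ratr q - x ord0 i| < m.+1%:R^-1.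
  have : x ord0 i - m.+1%:R^-1 < x ord0 i + m.+1%:R^-1.
    by rewrite ltrD2l gtrN// invr_gt0.
  move=> /rat_in_itvoo[q]; rewrite in_itv/= => hq; exists q.
  by rewrite ltr_distl.
exists (\row_i q i, m) => //; case: asboolP => [_|] i; first by rewrite mxE.
case: i => v hv; apply: eA; split=> // i0 i; rewrite (ord1 i0) /ball/=.
have := hv i; have := hq i; rewrite mxE/= => h1 h2.
rewrite (le_lt_trans (ler_distD (ratr (q i)) _ _))// distrC.
by rewrite [ltRHS]splitr ltrD// (lt_trans _ hm).
Qed.

Lemma measurable_funT_sqrt d (T : measurableType d) (h : T -> R) :
  measurable_fun [set: T] h -> measurable_fun [set: T] (fun x => Num.sqrt (h x)).
Proof.
apply: (@measurableT_comp _ _ _ _ _ _ (@Num.sqrt R)).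
by apply: continuous_measurable_fun; exact: sqrt_continuous.
Qed.

Lemma measurable_enorm_sub n (y : 'rV[R]_n) :
  measurable_fun [set: 'rV[R]_n] (fun x => enorm (x - y)).
Proof.
apply: measurable_funT_sqrt.
apply: measurable_sum => i; apply: measurable_funX.
apply: (eq_measurable_fun (fun x : 'rV[R]_n => x ord0 i - y ord0 i)).
  by move=> x _; rewrite !mxE.
by apply: measurable_funB => //; exact: measurable_coord.
Qed.

Lemma measurable_phi n kappa (Y : 'rV[R]_n * R) b :
  measurable_fun [set: 'rV[R]_n] (phi kappa Y b).
Proof.
apply: measurable_funB => //.
apply: measurable_funT_sqrt.
apply: measurable_funD => //; apply: measurable_funM => //.
by apply: measurable_funX; exact: measurable_enorm_sub.
Qed.

End row_measurability.

Section slices.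
Context {R : realType}.

Definition row_upd {n} (x : 'rV[R]_n) (j : 'I_n) (t : R) : 'rV[R]_n :=
  \row_k if k == j then t else x ord0 k.

Lemma row_cons_upd0 n t (v : 'rV[R]_n) :
  row_cons (t, v) = row_upd (row_cons (0, v)) ord0 t.
Proof.
apply/rowP => k; rewrite [RHS]mxE; case: (unliftP ord0 k) => [i|] ->.
  by rewrite !row_cons_tail.
by rewrite eqxx row_cons_head.
Qed.

Lemma row_cons_upd_lift n t (v : 'rV[R]_n) j s :
  row_cons (t, row_upd v j s) = row_upd (row_cons (t, v)) (lift ord0 j) s.
Proof.
apply/rowP => k; rewrite [RHS]mxE; case: (unliftP ord0 k) => [i|] ->.
  by rewrite !row_cons_tail/= mxE (inj_eq lift_inj).
by rewrite !row_cons_head.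
Qed.

(** Fubini and induction on the dimension. If [j] is the first coordinate, the one-dimensional
    slices are countable, hence null; otherwise the slices at a fixed first coordinate are null by
    induction. *)
Lemma lebesgue_row_borel_slice0 n (A : set 'rV[R]_n) (j : 'I_n) :
  measurable A -> (forall x, countable [set t | A (row_upd x j t)]) ->
  lebesgue_row_borel R n A = 0%E.
Proof.
elim: n A j => [A []//|n IH] A j mA A0.
pose X := @row_cons R n @^-1` A.
have mX : measurable X.
  by rewrite -[X in measurable X]setTI; exact: measurable_row_cons.
have -> : lebesgue_row_borel R n.+1 A =
  (lebesgue_measure \x lebesgue_row_borel R n)%E X by [].
case: (unliftP ord0 j) A0 => [k|] -> A0.
  apply: integral0_eq => t _; apply: (IH _ k); first exact: measurable_xsection.
  move=> v; rewrite (_ : [set _ | _] =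
      [set s | A (row_upd (row_cons (t, v)) (lift ord0 k) s)]); first exact: A0.
  by apply/funext => s; apply/propext; rewrite /= -row_cons_upd_lift; exact: xsectionP.
(* The first coordinate has to be integrated innermost here, so the order of integration is
   exchanged. *)
rewrite (@product_measure_unique _ _ _ _ _ _ _
  (lebesgue_measure \x^ lebesgue_row_borel R n)%E); first last.
- exact: mX.
- by move=> B C mB mC; exact: product_measure2E.
apply: integral0_eq => v _; apply: countable_lebesgue_measure0.
rewrite (_ : ysection X v = [set t | A (row_upd (row_cons (0, v)) ord0 t)]).
  exact: A0.
by apply/funext => t; apply/propext; rewrite /= -row_cons_upd0; exact: ysectionP.
Qed.

Lemma lebesgue_row_slice0 n (A : set 'rV[R]_n) (j : 'I_n) :
  measurable A -> (forall x, countable [set t | A (row_upd x j t)]) ->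
  lebesgue_row R n A = 0%E.
Proof.
by move=> mA A0; rewrite lebesgue_row_borelE// (lebesgue_row_borel_slice0 _ _ j).
Qed.

Lemma enorm_row_upd n (x y : 'rV[R]_n) j t :
  enorm (row_upd x j t - y) ^+ 2 =
  \sum_(i | i != j) (x ord0 i - y ord0 i) ^+ 2 + (t - y ord0 j) ^+ 2.
Proof.
rewrite sqr_sqrtr; last by apply: sumr_ge0 => i _; exact: sqr_ge0.
rewrite (bigD1 j)//= addrC; congr (_ + _); last by rewrite !mxE eqxx.
by apply: eq_bigr => i ij; rewrite !mxE (negbTE ij).
Qed.

End slices.

(** * Semi-discrete mass balance *)

Section cells.
Context {T : Type} {R : realType} {N : nat} (D : set T) (g : 'I_N -> R -> T -> R).
Implicit Types (b : 'I_N -> R) (i : 'I_N).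

(** Ties belong to every cell involved; [open_cell] keeps strict winners only, which makes open
    cells of distinct indices disjoint. *)
Definition cell b i : set T :=
  [set x | D x /\ forall j, g j (b j) x <= g i (b i) x].

Definition open_cell b i : set T :=
  [set x | D x /\ forall j, j != i -> g j (b j) x < g i (b i) x].

Lemma open_cell_sub b i : open_cell b i `<=` cell b i.
Proof.
move=> x [Dx h]; split=> // j.
by have [->//|/h/ltW] := eqVneq j i.
Qed.

Lemma cell_cover b x : 'I_N -> D x -> exists i, cell b i x.
Proof.
move=> o Dx.
case: (@arg_maxP _ _ _ o xpredT (fun i => g i (b i) x)) => // i _ h.
by exists i; split=> // j; exact: h.
Qed.

End cells.

Section semidiscrete.
Context d (T : measurableType d) (R : realType) (nu : {measure set T -> \bar R}).
Context (D : set T) (N : nat) (g : 'I_N -> R -> T -> R) (a : 'I_N -> R) (L : R).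
Hypothesis mD : measurable D.
Hypothesis mg : forall i s, measurable_fun D (g i s).
Hypothesis g_anti : forall i s t x, s < t -> g i t x < g i s x.
Hypothesis g_lip : forall i s t x, s <= t -> g i s x <= g i t x + L * (t - s).
Hypothesis L_gt0 : 0 < L.
Hypothesis tie0 : forall i j s t, i != j -> 0 < s -> 0 < t ->
  nu (D `&` [set x | g i s x = g j t x]) = 0%E.
Hypothesis nuD : nu D = (\sum_i a i)%:E.
Hypothesis a_gt0 : forall i, 0 < a i.
Implicit Types (b : 'I_N -> R) (i j k : 'I_N) (s t : R) (x : T).

Notation cell := (cell D g).
Notation open_cell := (open_cell D g).

Let upd b k t j := if j == k then t else b j.

Let finI (A : set 'I_N) : finite_set A.
Proof. exact: (sub_finite_set (@subsetT _ A)). Qed.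

Let g_antiW i s t x : s <= t -> g i t x <= g i s x.
Proof. by rewrite le_eqVlt => /predU1P[->|/g_anti/ltW]. Qed.

Lemma measurable_cell b i : measurable (cell b i).
Proof.
rewrite (_ : cell b i = D `&` \bigcap_(j in [set: 'I_N])
    (D `&` [set x | g j (b j) x <= g i (b i) x])).
  apply: measurableI => //; apply: fin_bigcap_measurable => // j _.
  exact: measurable_fun_le.
apply/seteqP; split=> x /=; first by case=> Dx h; split=> // j _; split=> //; exact: h.
by case=> Dx h; split=> // j; case: (h j).
Qed.

Let gltE i j s t : D `&` [set x | g j s x < g i t x] =
  D `\` (D `&` [set x | g i t x <= g j s x]).
Proof.
apply/seteqP; split=> x /=; first by case=> Dx h; split=> // -[_]; rewrite leNgt h.
by case=> Dx h; split=> //; rewrite ltNge; apply/negP => ?; exact: h.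
Qed.

Lemma measurable_open_cell b i : measurable (open_cell b i).
Proof.
rewrite (_ : open_cell b i = D `&` \bigcap_(j in [set j | j != i])
    (D `&` [set x | g j (b j) x < g i (b i) x])).
  apply: measurableI => //; apply: fin_bigcap_measurable => // j _.
  by rewrite gltE; apply: measurableD => //; exact: measurable_fun_le.
apply/seteqP; split=> x /=; first by case=> Dx h; split=> // j ji; split=> //; exact: h.
by case=> Dx h; split=> // j /h[].
Qed.

(** A point of the difference ties with another index, and the finitely many tie sets are null. *)
Lemma cellD_open_cell b i : (forall j, 0 < b j) ->
  nu (cell b i `\` open_cell b i) = 0%E.
Proof.
(* The index [i] contributes the empty set, since its tie with itself would be all of [D]. *)
move=> b0; pose N0 j := if j == i then set0 else
  D `&` [set x | g i (b i) x = g j (b j) x].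
have [mU U0] : measurable (\big[setU/set0]_j N0 j) /\
    nu (\big[setU/set0]_j N0 j) = 0%E.
  apply: (@big_ind _ (fun A => measurable A /\ nu A = 0%E)) => //.
  - by move=> A B [mA A0] [mB B0]; rewrite measureU0//; split=> //; exact: measurableU.
  - move=> j _; rewrite /N0; have [//|ji] := eqVneq j i; split.
      rewrite (_ : _ `&` _ = (D `&` [set x | g i (b i) x <= g j (b j) x]) `&`
          (D `&` [set x | g j (b j) x <= g i (b i) x])).
        by apply: measurableI; exact: measurable_fun_le.
      apply/seteqP; split=> x /=; first by case=> Dx ->.
      by case=> -[Dx h1] [_ h2]; split=> //; apply/le_anti/andP.
    by apply: tie0 => //; rewrite eq_sym.
apply: (subset_measure0 _ mU) => //.
  by apply: measurableD; [exact: measurable_cell|exact: measurable_open_cell].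
move=> x [[Dx h] nx]; apply: contrapT => xU; apply: nx; split=> // j ji.
rewrite lt_neqAle h andbT; apply/eqP => gji; apply: xU.
rewrite -bigcup_seq/=; exists j; first by rewrite /= mem_index_enum.
by rewrite /N0 (negbTE ji).
Qed.

Lemma nu_open_cell b i : (forall j, 0 < b j) -> nu (open_cell b i) = nu (cell b i).
Proof.
move=> b0; rewrite -[in RHS](setDUK (open_cell_sub D g b i)).
rewrite measureU0//; first exact: measurable_open_cell.
  by apply: measurableD; [exact: measurable_cell|exact: measurable_open_cell].
exact: cellD_open_cell.
Qed.

(** The open cells are pairwise disjoint and fill the union up to a null set. *)
Lemma nu_bigcup_cell b (P : pred 'I_N) : (forall j, 0 < b j) ->
  nu (\bigcup_(i in [set i | P i]) cell b i) = (\sum_(i | P i) nu (cell b i))%E.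
Proof.
move=> b0; pose O i := if P i then open_cell b i else set0.
pose Z i := cell b i `\` open_cell b i.
have mO i : measurable (O i).
  by rewrite /O; case: ifP => // _; exact: measurable_open_cell.
have mUO : measurable (\big[setU/set0]_i O i).
  by apply: (@big_ind _ measurable) => // A B; exact: measurableU.
have [mUZ UZ0] : measurable (\big[setU/set0]_i Z i) /\
    nu (\big[setU/set0]_i Z i) = 0%E.
  apply: (@big_ind _ (fun A => measurable A /\ nu A = 0%E)) => //.
    by move=> A B [mA A0] [mB B0]; rewrite measureU0//; split=> //; exact: measurableU.
  move=> i _; split; last exact: cellD_open_cell.
  by apply: measurableD; [exact: measurable_cell|exact: measurable_open_cell].
have mUP : measurable (\bigcup_(i in [set i | P i]) cell b i).
  apply: fin_bigcup_measurable => // i _; exact: measurable_cell.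
have inO x : (\big[setU/set0]_i O i) x <-> exists2 i, P i & open_cell b i x.
  rewrite -bigcup_seq/=; split=> [[i _]|[i Pi Ox]].
    by rewrite /O; case: ifP => // Pi Ox; exists i.
  by exists i; [rewrite /= mem_index_enum|rewrite /O Pi].
transitivity (nu (\big[setU/set0]_i O i)).
  apply/eqP; rewrite eq_le; apply/andP; split; last first.
    apply: le_measure; rewrite ?inE// => x /inO[i Pi Ox].
    by exists i => //; exact: open_cell_sub.
  rewrite -(measureU0 mUO mUZ UZ0)//; apply: le_measure; rewrite ?inE//.
    exact: measurableU.
  move=> x [i /= Pi Cx]; have [Ox|nOx] := pselect (open_cell b i x).
    by left; apply/inO; exists i.
  right; rewrite -bigcup_seq/=; exists i; first by rewrite /= mem_index_enum.
  by split.
rewrite measure_semi_additive_ord//; last first.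
  apply/trivIsetP => i j _ _ ij; apply/seteqP; split=> // x [].
  rewrite /O; case: ifP => // _ [_ hi]; case: ifP => // _ [_ hj].
  have := hi j; rewrite eq_sym => /(_ ij); rewrite ltNge.
  by rewrite (ltW (hj i ij)).
rewrite [RHS]big_mkcond/=; apply: eq_bigr => i _; rewrite /O.
by case: ifP => // _; rewrite ?measure0// nu_open_cell.
Qed.

Lemma sum_nu_cell b : 'I_N -> (forall j, 0 < b j) ->
  (\sum_i nu (cell b i) = (\sum_i a i)%:E)%E.
Proof.
move=> o b0; rewrite -nuD -nu_bigcup_cell//; congr (nu _).
apply/seteqP; split=> [x [i _ []]//|x /(cell_cover D g b _ o)[i Cx]].
by exists i.
Qed.

Let nu_cell_lty b i : (nu (cell b i) < +oo)%E.
Proof.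
rewrite (@le_lt_trans _ _ (nu D))//; last by rewrite nuD ltry.
by apply: le_measure; rewrite ?inE//; [exact: measurable_cell|move=> x []].
Qed.

Lemma nu_cell_le (b b' : 'I_N -> R) i :
  (forall j, j != i -> b' j <= b j) -> b i <= b' i ->
  cell b' i `<=` cell b i.
Proof.
move=> bb' bi x [Dx h]; split=> // j; have [->//|ji] := eqVneq j i.
by rewrite (le_trans (g_antiW _ _ _ _ (bb' _ ji)))// (le_trans (h j))// g_antiW.
Qed.

Let natV (n : nat) : R := n.+1%:R^-1.
Let natV_gt0 n : 0 < natV n. Proof. by rewrite invr_gt0. Qed.
Let natV_le m n : (m <= n)%N -> natV n <= natV m.
Proof. by move=> mn; rewrite lef_pV2 ?posrE// ler_nat. Qed.
Let natV_lt e : 0 < e -> \forall n \near \oo, natV n < e.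
Proof. by move=> e0; exact: (near_infty_natSinv_lt (PosNum e0)). Qed.

(** A strict win over finitely many competitors survives a small raise of [b i], by the Lipschitz
    bound. The raised open cells therefore increase to the open cell, and continuity from below
    applies. *)
Lemma nu_open_cell_cvg b i :
  nu (open_cell (upd b i (b i + natV n)) i) @[n --> \oo] --> nu (open_cell b i).
Proof.
have -> : open_cell b i = \bigcup_n open_cell (upd b i (b i + natV n)) i.
  apply/seteqP; split=> x; last first.
    move=> [n _ [Dx h]]; split=> // j ji; have := h j ji.
    rewrite /upd eqxx (negbTE ji) => /lt_le_trans; apply.
    by rewrite g_antiW// lerDl ltW.
  move=> [Dx h]; have : \forall n \near \oo, forall j, j != i ->
      g j (b j) x < g i (b i + natV n) x.
    apply: filter_forall => j; have [->|ji] := eqVneq j i; first exact: nearW.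
    have e0 : 0 < (g i (b i) x - g j (b j) x) / L.
      by rewrite divr_gt0// subr_gt0 h.
    apply: filterS (natV_lt _ e0) => n; rewrite ltr_pdivlMr// => hn _.
    have := g_lip i (b i) (b i + natV n) x; rewrite lerDl (ltW (natV_gt0 n)).
    by move=> /(_ isT); rewrite [_ + natV n - _]addrC addKr; lra.
  move=> /filter_ex[n hn]; exists n => //; split=> // j ji.
  by rewrite /upd eqxx (negbTE ji) hn.
apply: nondecreasing_cvg_mu => [n||m n mn].
- exact: measurable_open_cell.
- by apply: bigcup_measurable => n _; exact: measurable_open_cell.
- apply/subsetPset => x [Dx h]; split=> // j ji; have := h j ji.
  rewrite /upd eqxx (negbTE ji) => /lt_le_trans; apply.
  by rewrite g_antiW// lerD2l natV_le.
Qed.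

(** Dual to the previous limit: weak inequalities pass to the limit, so the enlarged cells decrease
    to the cell, and continuity from above applies since [nu D] is finite. *)
Lemma nu_cell_cvg b i :
  nu (cell (upd b i (b i - natV n)) i) @[n --> \oo] --> nu (cell b i).
Proof.
have -> : cell b i = \bigcap_n cell (upd b i (b i - natV n)) i.
  apply/seteqP; split=> x.
    move=> [Dx h] n _; split=> // j; have [->//|ji] := eqVneq j i.
    by rewrite /upd eqxx (negbTE ji) (le_trans (h j))// g_antiW// gerBl ltW.
  move=> h; have [Dx _] := h 0%N I; split=> // j.
  have [->//|ji] := eqVneq j i; apply/ler_addgt0Pl => e e0.
  have [n hn] := filter_ex (natV_lt _ (divr_gt0 e0 L_gt0)).
  have [_ /(_ j)] := h n I; rewrite /upd eqxx (negbTE ji) => /le_trans; apply.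
  have := g_lip i (b i - natV n) (b i) x; rewrite gerBl (ltW (natV_gt0 n)).
  move=> /(_ isT); rewrite (_ : b i - (b i - natV n) = natV n); last first.
    by rewrite opprB addrCA subrr addr0.
  by move: hn; rewrite ltr_pdivlMr//; lra.
apply: nonincreasing_cvg_mu => [|n||m n mn].
- exact: nu_cell_lty.
- exact: measurable_cell.
- by apply: bigcap_measurable => // n _; exact: measurable_cell.
- apply/subsetPset/nu_cell_le => [j ji|]; first by rewrite /upd (negbTE ji).
  by rewrite /upd eqxx lerD2l lerN2 natV_le.
Qed.

(** With [b o = beta], [hlo] empties the cell of [o] as soon as some other [b i] equals [lo], and
    [hhi] empties the cell of [i] once [b i] reaches [hi i]. *)
Lemma semidiscrete_exists (o : 'I_N) (beta lo : R) (hi : 'I_N -> R) :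
  0 < beta -> 0 < lo ->
  (forall i x, i != o -> D x -> g o beta x < g i lo x) ->
  (forall i x, i != o -> D x -> g i (hi i) x < g o beta x) ->
  exists b, [/\ b o = beta, forall i, 0 < b i & forall i, nu (cell b i) = (a i)%:E].
Proof.
move=> beta0 lo0 hlo hhi.
pose W := [set b | b o = beta /\ forall i, i != o -> lo <= b i /\
  (nu (cell b i) <= (a i)%:E)%E].
have W0 : W !=set0.
  exists (fun i => if i == o then beta else Num.max lo (hi i)).
  split=> [|i io]; first by rewrite eqxx.
  rewrite (negbTE io) le_max lexx; split=> //.
  rewrite (_ : cell _ i = set0) ?measure0 ?lee_fin ?ltW//.
  apply/seteqP; split=> // x [Dx /(_ o)]; rewrite eqxx (negbTE io) leNgt.
  by rewrite (le_lt_trans _ (hhi i x io Dx))// g_antiW// le_max lexx orbT.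
pose B i := [set c i | c in W].
pose b i := inf (B i).
have B0 i : B i !=set0 by case: W0 => c Wc; exists (c i); exists c.
have Blb i : has_lbound (B i).
  exists (if i == o then beta else lo) => _ [c [co hc] <-].
  by have [->|/hc[]//] := eqVneq i o; rewrite co.
have b_le c i : W c -> b i <= c i by move=> Wc; apply: ge_inf => //; exists c.
have lo_b i : i != o -> lo <= b i.
  by move=> io; apply: lb_le_inf => // _ [c [_ /(_ i io)[? _]] <-].
have bo : b o = beta.
  apply/le_anti/andP; split; first by case: W0 => c Wc; rewrite -(Wc.1) b_le.
  by apply: lb_le_inf => // _ [c [-> _] <-].
have b_gt0 i : 0 < b i.
  by have [->|io] := eqVneq i o; [rewrite bo|rewrite (lt_le_trans lo0)// lo_b].
(* Some [c] in [W] has [c i < b i + natV n], and [b <= c] in all other coordinates. Raising only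
   [b i] thus gives an open cell inside the cell of [c], whose mass is at most [a i]; then [n] tends
   to infinity. *)
have le_a i : i != o -> (nu (cell b i) <= (a i)%:E)%E.
  move=> io; rewrite -nu_open_cell//.
  have cv := nu_open_cell_cvg b i.
  rewrite -(cvg_lim _ cv)//; apply: lime_le; first by apply/cvg_ex; eexists; exact: cv.
  apply: nearW => n.
  have [_ [c Wc <-] cb] := inf_adherent (natV_gt0 n) (conj (B0 i) (Blb i)).
  have [_ /(_ i io)[_ ca]] := Wc; rewrite (le_trans _ ca)//.
  apply: le_measure; rewrite ?inE; [exact: measurable_open_cell|exact: measurable_cell|].
  move=> x [Dx h]; split=> // j; have [->//|ji] := eqVneq j i.
  rewrite (le_trans (g_antiW _ _ _ _ (b_le _ j Wc)))//.
  have := h j ji; rewrite /upd eqxx (negbTE ji) => /ltW/le_trans; apply.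
  by rewrite g_antiW// ltW.
have fin i : nu (cell b i) \is a fin_num by rewrite ge0_fin_numE.
have sumb : \sum_i fine (nu (cell b i)) = \sum_i a i.
  apply: EFin_inj; rewrite -(sum_nu_cell _ o b_gt0) -sumEFin.
  by apply: eq_bigr => i _; rewrite fineK.
have nu_o : a o <= fine (nu (cell b o)).
  have : \sum_(i | i != o) fine (nu (cell b i)) <= \sum_(i | i != o) a i.
    by apply: ler_sum => i io; rewrite -lee_fin fineK// le_a.
  by move: sumb; rewrite (bigD1 o)//= [RHS](bigD1 o)//=; lra.
(* Equality would empty the cell of [o], which carries at least [a o > 0]. The strict inequality
   leaves room to lower [b i]. *)
have lo_lt i : i != o -> lo < b i.
  move=> io; rewrite lt_neqAle lo_b// andbT; apply/eqP => lob.
  suff co : cell b o = set0 by move: nu_o; rewrite co measure0/= leNgt a_gt0.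
  apply/seteqP; split=> // x [Dx /(_ i)]; rewrite bo -lob leNgt.
  by rewrite hlo.
(* If the cell were still below [a i] after lowering [b i] slightly, the lowered vector would lie in
   [W], the other cells having shrunk, against the choice of [b i] as infimum. *)
have a_le i : i != o -> ((a i)%:E <= nu (cell b i))%E.
  move=> io; have cv := nu_cell_cvg b i.
  rewrite -(cvg_lim _ cv)//; apply: lime_ge; first by apply/cvg_ex; eexists; exact: cv.
  have e0 : 0 < b i - lo by rewrite subr_gt0 lo_lt.
  apply: filterS (natV_lt _ e0) => n hn; rewrite leNgt; apply/negP => lta.
  have : W (upd b i (b i - natV n)).
    split=> [|j jo]; first by rewrite /upd eq_sym (negbTE io).
    have [->|ji] := eqVneq j i.
      by rewrite (ltW lta) /upd eqxx; split=> //; lra.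
    rewrite {1}/upd (negbTE ji); split; first exact: lo_b.
    rewrite (le_trans _ (le_a _ jo))//; apply: le_measure; rewrite ?inE.
    - exact: measurable_cell.
    - exact: measurable_cell.
    apply: nu_cell_le => [k _|]; last by rewrite /upd (negbTE ji).
    by rewrite /upd; case: ifP => // /eqP ->; rewrite gerBl ltW.
  move=> /b_le-/(_ i); rewrite /upd eqxx leNgt; apply/negP.
  by rewrite negbK ltrBlDr ltrDl.
exists b; split=> // i; have [->|io] := eqVneq i o; last first.
  by apply/le_anti; rewrite le_a// a_le.
rewrite -(fineK (fin o)); congr EFin.
have : \sum_(i | i != o) fine (nu (cell b i)) = \sum_(i | i != o) a i.
  apply: eq_bigr => j jo; apply: EFin_inj; rewrite fineK//.
  by apply/le_anti; rewrite le_a// a_le.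
by move: sumb; rewrite (bigD1 o)//= [RHS](bigD1 o)//=; lra.
Qed.

End semidiscrete.

(** * Coincidence sets of two sheets *)

Section ties.
Context {R : realType}.

Lemma finite_quadratic (al be ga : R) : ~ [/\ al = 0, be = 0 & ga = 0] ->
  finite_set [set t | al * t ^+ 2 + be * t + ga = 0].
Proof.
move=> n0; have [al0|al0] := eqVneq al 0.
  have [be0|be0] := eqVneq be 0.
    rewrite (_ : [set _ | _] = set0) ?finite_set0//; apply/seteqP; split=> // t /=.
    by rewrite al0 be0 !mul0r !add0r => ga0; exact: n0.
  apply: (sub_finite_set (B := [set - ga / be])) => [t /= h|]; last exact: finite_set1.
  apply: (mulIf be0); rewrite divfK//; move: h; rewrite al0 mul0r add0r.
  by move/eqP; rewrite addr_eq0 mulrC => /eqP.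
pose m := be / (2 * al); pose s := Num.sqrt (m ^+ 2 - ga / al).
apply: (sub_finite_set (B := [set s - m; - s - m])) => [t /= h|]; last first.
  by rewrite finite_setU; split; exact: finite_set1.
have sq : (t + m) ^+ 2 = m ^+ 2 - ga / al.
  have -> : (t + m) ^+ 2 = m ^+ 2 - ga / al + (al * t ^+ 2 + be * t + ga) / al.
    by rewrite /m; field.
  by rewrite h mul0r addr0.
have : `|t + m| = s by rewrite /s -sq sqrtr_sqr.
by case: ler0P => _ <-; [right|left]; rewrite ?opprK addrK.
Qed.

Lemma finite_sqr_affine_eq (P M a E e c : R) : a != 0 -> 0 < E -> 0 < c ->
  finite_set [set t | (P + M * t) ^+ 2 = 4 * a ^+ 2 * (E + c * (t - e) ^+ 2)].
Proof.
move=> a0 E0 c0; have a2 : 0 < 4 * a ^+ 2 by rewrite mulr_gt0// exprn_even_gt0.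
pose al := M ^+ 2 - 4 * a ^+ 2 * c; pose be := 2 * P * M + 8 * a ^+ 2 * c * e.
pose ga := P ^+ 2 - 4 * a ^+ 2 * (E + c * e ^+ 2).
have polE t : al * t ^+ 2 + be * t + ga =
    (P + M * t) ^+ 2 - 4 * a ^+ 2 * (E + c * (t - e) ^+ 2).
  by rewrite /al /be /ga; ring.
rewrite (_ : [set _ | _] = [set t | al * t ^+ 2 + be * t + ga = 0]); last first.
  apply/funext => t; apply/propext; rewrite /= polE.
  by split=> [->|/eqP]; [rewrite subrr|rewrite subr_eq0 => /eqP].
(* A quadratic in [t] that is positive everywhere is not the square of an
   affine function. *)
apply: finite_quadratic => -[al0 be0 ga0].
have [M0|M0] := eqVneq M 0.
  have : 0 < 4 * a ^+ 2 * c by rewrite mulr_gt0.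
  by move: al0; rewrite /al M0; lra.
have := polE (- P / M); rewrite al0 be0 ga0 !mul0r !addr0 mulrC divfK// subrr.
have : 0 < 4 * a ^+ 2 * (E + c * (- P / M - e) ^+ 2).
  by rewrite mulr_gt0// ltr_wpDr// mulr_ge0 ?sqr_ge0// ltW.
rewrite expr0n/=; lra.
Qed.

Lemma measurable_phi_tie n (kappa : R) (Y Y' : 'rV[R]_n * R) (b b' : R) :
  measurable [set x | phi kappa Y b x = phi kappa Y' b' x].
Proof.
rewrite (_ : [set _ | _] = (setT `&` [set x | phi kappa Y b x <= phi kappa Y' b' x]) `&`
    (setT `&` [set x | phi kappa Y' b' x <= phi kappa Y b x])).
  by apply: measurableI; apply: measurable_fun_le => //; exact: measurable_phi.
rewrite !setTI; apply/seteqP; split=> x /=; first by move=> ->.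
by move=> [h1 h2]; apply/le_anti/andP.
Qed.

(** Unless the set is empty, eliminating the roots leaves a nontrivial equation of degree at most
    two along the lines of some coordinate direction. *)
Lemma lebesgue_phi_tie n (j0 : 'I_n) (kappa : R) (Y Y' : 'rV[R]_n * R) (b b' : R) :
  1 < kappa -> Y != Y' -> 0 < b -> 0 < b' ->
  lebesgue_row R n [set x | phi kappa Y b x = phi kappa Y' b' x] = 0%E.
Proof.
move=> k1 YY' b0 b'0; set q := kappa ^+ 2 - 1.
have q0 : 0 < q by rewrite subr_gt0 exprn_egt1.
have qN0 : q != 0 by rewrite gt_eqF.
set A := [set x | _].
have mA : measurable A by exact: measurable_phi_tie.
(* On [A] this constant is the difference of the two roots. *)
pose a := Y.2 - kappa * b / q - (Y'.2 - kappa * b' / q).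
pose Q (Y : 'rV[R]_n * R) b x := b ^+ 2 / q ^+ 2 + enorm (x - Y.1) ^+ 2 / q.
have Q0 Z c x : 0 < c -> 0 < Q Z c x.
  move=> c0; rewrite ltr_wpDr ?divr_ge0 ?sqr_ge0 ?ltW//.
  by rewrite divr_gt0// exprn_gt0.
have AS x : A x -> Num.sqrt (Q Y b x) = Num.sqrt (Q Y' b' x) + a.
  by rewrite /A/= /phi -/(Q Y b x) -/(Q Y' b' x) -/q /a; lra.
have Qupd Z c x j t : Q Z c (row_upd x j t) = c ^+ 2 / q ^+ 2 +
    (\sum_(i | i != j) (x ord0 i - Z.1 ord0 i) ^+ 2 + (t - Z.1 ord0 j) ^+ 2) / q.
  by rewrite /Q enorm_row_upd.
(* For [a != 0], squaring gives [Q - Q' - a ^+ 2 = 2 * a * sqrt Q']. The left side is affine in [t],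
   as the quadratic terms cancel, and a second squaring removes the root. Any direction works. *)
have [a0|a0] := eqVneq a 0; last first.
  apply: (lebesgue_row_slice0 _ _ j0) => // x; apply: finite_set_countable.
  pose K (Z : 'rV[R]_n * R) := \sum_(i | i != j0) (x ord0 i - Z.1 ord0 i) ^+ 2.
  pose y := Y.1 ord0 j0; pose y' := Y'.1 ord0 j0.
  pose P := (b ^+ 2 / q ^+ 2 - b' ^+ 2 / q ^+ 2) +
    (K Y - K Y' + y ^+ 2 - y' ^+ 2) / q - a ^+ 2.
  apply: (sub_finite_set (B := [set t | (P + (2 * (y' - y) / q) * t) ^+ 2 =
    4 * a ^+ 2 * ((b' ^+ 2 / q ^+ 2 + K Y' / q) + q^-1 * (t - y') ^+ 2)])); last first.
    apply: finite_sqr_affine_eq => //; last by rewrite invr_gt0.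
    rewrite ltr_wpDr ?divr_gt0 ?exprn_gt0//.
    by apply: divr_ge0; [apply: sumr_ge0 => i _; exact: sqr_ge0|exact: ltW].
  move=> t /AS; set x' := row_upd x j0 t => h /=.
  have -> : P + 2 * (y' - y) / q * t = Q Y b x' - Q Y' b' x' - a ^+ 2.
    by rewrite !Qupd /P -/(K Y) -/(K Y') -/y -/y'; field.
  have -> : (b' ^+ 2 / q ^+ 2 + K Y' / q) + q^-1 * (t - y') ^+ 2 = Q Y' b' x'.
    by rewrite !Qupd -/(K Y') -/y'; field.
  have s1 := sqr_sqrtr (ltW (Q0 Y b x' b0)); have s2 := sqr_sqrtr (ltW (Q0 Y' b' x' b'0)).
  move: (Num.sqrt (Q Y' b' x')) s2 h => r s2 h.
  by rewrite -s1 h -s2; ring.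
have AQ x : A x -> Q Y b x = Q Y' b' x.
  move=> /AS; rewrite a0 addr0 => h.
  by rewrite -(sqr_sqrtr (ltW (Q0 Y b x b0))) h sqr_sqrtr// ltW// Q0.
(* For [a = 0] the radicands agree. Over a common axis this forces [b = b'] and then [Y = Y'];
   otherwise a coordinate separating the axes gives an affine equation of nonzero slope. *)
have [y1|] := eqVneq Y.1 Y'.1.
  suff -> : A = set0 by rewrite measure0.
  apply/seteqP; split=> // x /AQ; rewrite /Q y1 => /addIr.
  move=> /(mulIf (invr_neq0 (expf_neq0 2 qN0)))/eqP.
  rewrite eqrXn2 ?ltW// => /eqP bb'; move/eqP: YY'; apply.
  rewrite [Y]surjective_pairing [Y']surjective_pairing y1; congr pair.
  by move: a0; rewrite /a bb'; lra.
move=> y1; have [j yj] : exists j, Y.1 ord0 j != Y'.1 ord0 j.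
  apply/existsP; apply: contra_neqT y1 => /existsPn h; apply/rowP => j.
  by have := h j; rewrite negbK => /eqP.
apply: (lebesgue_row_slice0 _ _ j) => // x; apply: finite_set_countable.
pose K (Z : 'rV[R]_n * R) := \sum_(i | i != j) (x ord0 i - Z.1 ord0 i) ^+ 2.
pose y := Y.1 ord0 j; pose y' := Y'.1 ord0 j.
pose ga := (b ^+ 2 / q ^+ 2 - b' ^+ 2 / q ^+ 2) + (K Y - K Y' + y ^+ 2 - y' ^+ 2) / q.
apply: (sub_finite_set (B := [set t | 0 * t ^+ 2 + (2 * (y' - y) / q) * t + ga = 0])).
  move=> t /AQ; set x' := row_upd x j t => h /=.
  have -> : 0 * t ^+ 2 + 2 * (y' - y) / q * t + ga = Q Y b x' - Q Y' b' x'.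
    by rewrite !Qupd /ga -/(K Y) -/(K Y') -/y -/y'; field.
  by rewrite h subrr.
apply: finite_quadratic => -[_ /eqP + _]; rewrite !mulf_eq0 invr_eq0 pnatr_eq0/=.
by rewrite (negbTE qN0) orbF subr_eq0 eq_sym (negbTE yj).
Qed.

End ties.

(** * Measures given by a density, and bounded domains *)

Section density.
Local Open Scope ereal_scope.
Context {d} {T : measurableType d} {R : realType} (m : {measure set T -> \bar R}).

(** The proofs [F0] and [mF] are arguments so that the measure structure can be attached to the term
    itself. *)
Definition density (F : T -> \bar R) (F0 : forall x, 0 <= F x)
  (mF : measurable_fun [set: T] F) (A : set T) : \bar R := \int[m]_(x in A) F x.

Context (F : T -> \bar R) (F0 : forall x, 0 <= F x).
Context (mF : measurable_fun [set: T] F).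
Notation nu := (density F F0 mF).

Let nu0 : nu set0 = 0. Proof. exact: integral_set0. Qed.

Let nu_ge0 A : 0 <= nu A. Proof. by apply: integral_ge0 => x _; exact: F0. Qed.

Let nu_sigma_additive : semi_sigma_additive nu.
Proof.
move=> A mA tA mUA; rewrite /density ge0_integral_bigcup//; last first.
  exact: measurable_funTS.
by apply: is_cvg_nneseries => k _ _; exact: nu_ge0.
Qed.

HB.instance Definition _ := isMeasure.Build _ _ _ nu nu0 nu_ge0 nu_sigma_additive.

End density.

Section domain.
Context {R : realType} {n : nat}.
Implicit Types (A Omega : set 'rV[R]_n) (x y : 'rV[R]_n).

Lemma lebesgue_measurableW A : measurable A -> lebesgue_measurable A.
Proof. by move=> mA; apply: sub_caratheodory; exact: sub_sigma_algebra. Qed.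

(** [diam] is a real supremum, so the distances must first be bounded: a sup-norm bound controls
    each coordinate, hence the Euclidean norm. *)
Lemma enorm_le_diam Omega x y : bounded_set Omega -> Omega x ->
  enorm (x - y) <= diam (Omega `|` [set y]).
Proof.
move=> bO Ox; apply: ub_le_sup; last by exists x; [left|exists y => //; right].
have [M0 [_ /(_ (M0 + 1))]] := bO; rewrite ltrDl ltr01 => /(_ isT) hM; pose M := M0 + 1.
pose C := `|M| + `|y|.
have C0 : 0 <= C by rewrite addr_ge0.
have nC z : (Omega `|` [set y]) z -> `|z| <= C.
  move=> [/hM/= zM|->]; last by rewrite lerDr.
  by rewrite (le_trans zM)// (le_trans (ler_norm _))// lerDl.
exists (Num.sqrt (\sum_(i < n) (C + C) ^+ 2)) => _ [z zO [z' z'O <-]].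
rewrite ler_sqrt ?sumr_ge0// => [|i _]; last exact: sqr_ge0.
apply: ler_sum => i _; rewrite -real_normK ?num_real// ler_pXn2r ?nnegrE ?addr_ge0//.
have coord (v : 'rV[R]_n) : `|v ord0 i| <= `|v|.
  by rewrite [leRHS]mx_normrE; exact: (le_bigmax _ (fun ij => `|v ij.1 ij.2|) (ord0, i)).
rewrite !mxE (le_trans (ler_normB _ _))// lerD// (le_trans (coord _))//; exact: nC.
Qed.

Lemma dim_gt0_of_diam A : A !=set0 -> 0 < diam A -> (0 < n)%N.
Proof.
move=> [x Ax]; rewrite lt0n => dA; apply/eqP => n0; move: dA; rewrite ltNge => /negP.
apply; apply: ge_sup; first by exists (enorm (x - x)); exists x => //; exists x.
move=> _ [z _ [z' _ <-]]; rewrite /enorm big1 ?sqrtr0// => i _.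
by have := ltn_ord i; rewrite {2}n0.
Qed.

Lemma lebesgue_row_enorm0 (j0 : 'I_n) y :
  measurable [set x | enorm (x - y) = 0] /\
  lebesgue_row R n [set x | enorm (x - y) = 0] = 0%E.
Proof.
have mA : measurable [set x | enorm (x - y) = 0].
  rewrite -[X in measurable X]setTI.
  exact: (measurable_enorm_sub _ _ measurableT _ (measurable_set1 0)).
split=> //; apply: (lebesgue_row_slice0 _ _ j0) => // x.
apply: finite_set_countable.
apply: (sub_finite_set (B := [set y ord0 j0])) => [t /= h|]; last exact: finite_set1.
have := enorm_row_upd _ x y j0 t; rewrite h expr0n/= => /esym/eqP.
rewrite paddr_eq0 ?sqr_ge0//; last by apply: sumr_ge0 => i _; exact: sqr_ge0.
by rewrite sqrf_eq0 subr_eq0 => /andP[_ /eqP].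
Qed.

End domain.

(** * Height bounds and the tracing map *)

Section heights.
Context {R : realType} (w kappa Delta : R).
Hypotheses (w_gt0 : 0 < w) (kappa_gt1 : 1 < kappa) (Delta_gt0 : 0 < Delta).

(** The depth below the focus of the vertex of the sheet with parameter [psi t]. *)
Definition psi_scaled (t : R) : R := (kappa - 1)^-1 * psi kappa Delta t.

Lemma psi_scaled_lt t : psi_scaled t < t.
Proof.
rewrite /psi_scaled mulrC ltr_pdivrMr ?subr_gt0// mulrC.
exact: psi_lt.
Qed.

Lemma psi_scaled_ge t : 0 <= t -> t - Delta / (kappa - 1) <= psi_scaled t.
Proof.
move=> t0; rewrite /psi_scaled [leRHS]mulrC ler_pdivlMr ?subr_gt0// mulrBl.
rewrite divfK ?gt_eqF ?subr_gt0// mulrC; exact: psi_ge (ltW _) t0.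
Qed.

Lemma psi_scaledE t : (kappa - 1) * psi_scaled t = psi kappa Delta t.
Proof. by rewrite /psi_scaled mulrA divff ?mul1r// gt_eqF// subr_gt0. Qed.

(** Each [psi_scaled] loses at most [c = Delta / (kappa - 1)], so [tau0] is at most [2 * w + 3 * c],
    a bound independent of [tau1]. *)
Lemma psi_scaled_threshold : exists T : R, forall tau1, T <= tau1 ->
  let delta := psi kappa Delta (psi_scaled (psi_scaled tau1) - w) in
  [/\ Num.max (kappa * tau0 kappa Delta w tau1)
        (tau0 kappa Delta w tau1 + kappa * Delta / (kappa - 1)) <= tau1,
      0 < delta & Delta / Num.sqrt (kappa ^+ 2 - 1) < tau1].
Proof.
pose c := Delta / (kappa - 1); pose r := Delta / Num.sqrt (kappa ^+ 2 - 1).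
have k0 : 0 < kappa - 1 by rewrite subr_gt0.
have c0 : 0 < c by rewrite divr_gt0.
have r0 : 0 < r.
  by rewrite divr_gt0// sqrtr_gt0 subr_gt0 exprn_egt1.
pose u := 2 * w + 3 * c.
have u0 : 0 < u by rewrite /u; move: w_gt0; lra.
have ku : 0 < (kappa - 1) * u by rewrite mulr_gt0.
have kc : 0 < (kappa - 1) * c by rewrite mulr_gt0.
exists (kappa * u + u + kappa * c + r + 1) => tau1 tau1T.
set s1 := psi_scaled tau1; set s2 := psi_scaled s1 => delta.
have uE : u = 2 * w + 3 * c by [].
have h1 : tau1 - c <= s1 by apply: psi_scaled_ge; lra.
have h2 : s1 - c <= s2 by apply: psi_scaled_ge; lra.
have h3 : s2 - w - c <= psi_scaled (s2 - w) by apply: psi_scaled_ge; lra.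
have t0E : tau0 kappa Delta w tau1 = tau1 + w - psi_scaled (s2 - w).
  by rewrite /tau0 /psi_scaled [in RHS]mulrC.
have t0u : tau0 kappa Delta w tau1 <= u by rewrite t0E; lra.
split; last by rewrite -/r; lra.
- rewrite ge_max -mulrA -/c; apply/andP; split; last lra.
  have : kappa * tau0 kappa Delta w tau1 <= kappa * u by rewrite ler_pM2l//; lra.
  lra.
- by rewrite /delta -psi_scaledE mulr_gt0//; move: w_gt0; lra.
Qed.

End heights.

Section refractor_geometry.
Context {R : realType} (w kappa Delta tau1 : R) {n : nat}.
Context (Omega : set 'rV[R]_n) (N : nat) (Y : 'I_N -> 'rV[R]_n * R).
Hypotheses (w_gt0 : 0 < w) (kappa_gt1 : 1 < kappa) (Delta_gt0 : 0 < Delta).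
Hypothesis Y_slab : forall i, tau1 <= (Y i).2 <= tau1 + w.
Hypothesis Y_dist : forall i x, Omega x -> enorm (x - (Y i).1) <= Delta.

(** Over [Omega], the sheet with parameter [beta] stays between the depths [s2], its vertex, and
    [s1] below its focus. *)
Let s1 := psi_scaled kappa Delta tau1.
Let s2 := psi_scaled kappa Delta s1.
Let beta := psi kappa Delta s1.
Let delta := psi kappa Delta (s2 - w).

Let k0 : 0 < kappa - 1. Proof. by rewrite subr_gt0. Qed.
Let betaE : beta / (kappa - 1) = s2. Proof. by rewrite mulrC. Qed.

Lemma phi_beta_ge o x : Omega x -> (Y o).2 - s1 <= phi kappa (Y o) beta x.
Proof. by move=> Ox; apply: phi_psi_ge => //; exact: Y_dist. Qed.

(** The vertex over [Y o] is at most at [tau1 + w - s2], and the sheet of [Y i] stays above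
    [(Y i).2 - (s2 - w)], which is no lower. *)
Lemma phi_beta_lt_of_lt_delta o i b x : Omega x -> b < delta ->
  phi kappa (Y o) beta x < phi kappa (Y i) b x.
Proof.
move=> Ox bd; have := phi_le_top _ kappa_gt1 (Y o) beta x; rewrite betaE.
have := phi_gt _ _ kappa_gt1 (Y i) b _ x (Y_dist i x Ox) bd.
have /andP[] := Y_slab i; have /andP[] := Y_slab o; lra.
Qed.

(** Beyond this threshold even the vertex over [Y i] lies below the lower bound [(Y o).2 - s1]. *)
Lemma phi_lt_beta_of_gt o i b x : Omega x ->
  (kappa - 1) * ((Y i).2 - (Y o).2 + s1) < b ->
  phi kappa (Y i) b x < phi kappa (Y o) beta x.
Proof.
move=> Ox; rewrite mulrC -ltr_pdivlMr// => bd.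
have := phi_le_top _ kappa_gt1 (Y i) b x.
have := phi_beta_ge o x Ox; lra.
Qed.

(** The vertex over [Y i] must exceed [(Y o).2 - s1], strictly since [x] is off the axis. This
    bounds [b] by [(kappa - 1) * ((Y i).2 - tau1) + psi tau1], and [psi] grows at rate at least
    [kappa - 1]. *)
Lemma phi_ge_beta_lt_psi o i b x : Omega x -> enorm (x - (Y i).1) != 0 ->
  phi kappa (Y o) beta x <= phi kappa (Y i) b x -> b < psi kappa Delta (Y i).2.
Proof.
move=> Ox xY le; have /andP[Yi _] := Y_slab i; have /andP[Yo _] := Y_slab o.
apply: lt_le_trans (psi_sub kappa Delta _ _ Yi).
have lt := phi_lt_top _ kappa_gt1 (Y i) b x xY; have ge := phi_beta_ge o x Ox.
have : b / (kappa - 1) < (Y i).2 - tau1 + s1 by lra.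
rewrite ltr_pdivrMr// => /lt_le_trans; apply.
by rewrite mulrC mulrDr psi_scaledE.
Qed.

Lemma phi_beta_gt0 o x : Omega x -> 0 < phi kappa (Y o) beta x.
Proof.
move=> /(phi_beta_ge o); apply: lt_le_trans; have /andP[Yo _] := Y_slab o.
have := psi_scaled_lt kappa Delta kappa_gt1 Delta_gt0 tau1; rewrite -/s1; lra.
Qed.

Lemma phi_le_tau0 i b x : delta <= b ->
  phi kappa (Y i) b x <= tau0 kappa Delta w tau1.
Proof.
move=> db; rewrite (le_trans (phi_le_top _ kappa_gt1 (Y i) b x))//.
have /andP[_ Yi] := Y_slab i.
have : delta / (kappa - 1) <= b / (kappa - 1) by rewrite ler_pM2r ?invr_gt0.
by rewrite /tau0 -/(psi_scaled kappa Delta tau1) -/s1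
  -/(psi_scaled kappa Delta s1) -/s2 -/delta; lra.
Qed.

End refractor_geometry.

Section envelope.
Context {R : realType} (kappa : R) {n : nat} (Omega : set 'rV[R]_n).
Context (N : nat) (Y : 'I_N -> 'rV[R]_n * R) (b : 'I_N -> R) (o : 'I_N).
Hypothesis kappa_gt1 : 1 < kappa.

(** The default value is the sheet of [o], itself one of the terms, so it does not alter the
    maximum. *)
Definition envelope (x : 'rV[R]_n) : R :=
  \big[Num.max/phi kappa (Y o) (b o) x]_i phi kappa (Y i) (b i) x.

Let phis i s x := phi kappa (Y i) s x.

Lemma phi_le_envelope i x : phi kappa (Y i) (b i) x <= envelope x.
Proof. exact: (le_bigmax _ (fun i => phi kappa (Y i) (b i) x)). Qed.

Lemma envelope_cell i x : cell Omega phis b i x ->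
  envelope x = phi kappa (Y i) (b i) x.
Proof.
move=> [_ h]; apply/le_anti; rewrite phi_le_envelope andbT.
by apply/bigmax_leP; split=> [|j _]; exact: h.
Qed.

(* Where [phi_(Y i, b')] touches the envelope, [b' = b i]: a larger [b'] lies
   strictly below it, a smaller one strictly above it on the cell. *)
Lemma tracing_envelope i : 0 < b i -> cell Omega phis b i !=set0 ->
  tracing kappa Omega envelope (Y i) = cell Omega phis b i.
Proof.
move=> bi0 [z Cz]; apply/seteqP; split=> x; last first.
  move=> Cx; split; first by case: Cx.
  by exists (b i); split=> // [y _|]; [exact: phi_le_envelope|exact: envelope_cell].
move=> [Ox [b' [_ le' eq']]]; suff b'E : b' = b i.
  split=> // j; rewrite /phis -b'E -eq'; exact: phi_le_envelope.
apply/le_anti/andP; split; rewrite leNgt; apply/negP => lt.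
  have := phi_le_envelope i x; rewrite eq' leNgt.
  by rewrite (phi_anti _ kappa_gt1 (Y i) _ _ x lt).
have [Oz _] := Cz; have := le' z Oz; rewrite (envelope_cell _ _ Cz) leNgt.
by rewrite (phi_anti _ kappa_gt1 (Y i) _ _ z lt).
Qed.

End envelope.

(** * Existence of the refractor from balanced cells *)

Theorem theorem6p1 (R : realType) (w kappa Delta : R)
    (hw : 0 < w) (hkappa : 1 < kappa) (hDelta : 0 < Delta) :
  exists T : R, forall tau1 : R, T <= tau1 ->
  let t0 := tau0 kappa Delta w tau1 in
  Num.max (kappa * t0) (t0 + kappa * Delta / (kappa - 1)) <= tau1 /\
  forall (n : nat) (Omega : set 'rV[R]_n)
         (N : nat) (Y : 'I_N -> 'rV[R]_n * R) (f : 'rV[R]_n -> R)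
         (a : 'I_N -> R),
  let Sigma := range Y in
  let lambda := lebesgue_row R n in
  let mu := fun E : set ('rV[R]_n * R) =>
    (\sum_(i < N) (a i)%:E * \d_(Y i) E)%E in
  bounded_convex_domain Omega ->
  injective Y ->
  (forall i, tau1 <= (Y i).2 <= tau1 + w) ->
  \big[Num.max/0]_(i < N) diam (Omega `|` [set (Y i).1]) = Delta ->
  visible Omega t0 Sigma ->
  lambda.-integrable Omega (EFin \o f) ->
  (forall x, Omega x -> 0 <= f x) ->
  (forall i, 0 < a i) ->
  (\int[lambda]_(x in Omega) (f x)%:E = (\sum_(i < N) a i)%:E)%E ->
  exists u : 'rV[R]_n -> R,
  [/\ forall x, Omega x -> 0 <= u x <= t0,
      is_refractor kappa Delta Omega Sigma u &
      forall E, E `<=` Sigma ->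
        let TE := tracing_set kappa Omega u E in
        lebesgue_measurable TE /\
        (\int[lambda]_(x in TE) (f x)%:E = mu E)%E].
Proof.
have [T hT] := psi_scaled_threshold w kappa Delta hw hkappa hDelta.
exists T => tau1 /hT[tau1_ge delta0 tau1_gt] t0; split=> //.
move=> n Omega N Y f a Sigma lambda mu.
move=> [[z Oz] oO bO _] injY slab diamE _ intf f0 a0 massf.
set s1 := psi_scaled kappa Delta tau1 in delta0.
set s2 := psi_scaled kappa Delta s1 in delta0.
set delta := psi kappa Delta (s2 - w) in delta0.
pose beta := psi kappa Delta s1.
have dist i x : Omega x -> enorm (x - (Y i).1) <= Delta.
  move=> Ox; rewrite (le_trans (enorm_le_diam _ x (Y i).1 bO Ox))// -diamE.
  exact: (le_bigmax _ (fun i => diam (Omega `|` [set (Y i).1]))).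
(* A maximum with default 0 equal to [Delta > 0] is reached by an actual index. This gives the
   reference focus [p] and, below, a positive dimension. *)
have [p diamp] : exists p, 0 < diam (Omega `|` [set (Y p).1]).
  apply: contrapT => no.
  suff : \big[Num.max/0]_(i < N) diam (Omega `|` [set (Y i).1]) <= 0.
    by rewrite diamE leNgt hDelta.
  apply/bigmax_leP; split=> // i _; rewrite leNgt; apply/negP => di.
  by apply: no; exists i.
have n_gt0 : (0 < n)%N by apply: (dim_gt0_of_diam _ _ diamp); exists z; left.
pose j0 : 'I_n := Ordinal n_gt0.
pose mT : measurableType _ := caratheodory_type (lebesgue_row_borel R n)^*%mu.
have mO : measurable (Omega : set mT).
  by apply: lebesgue_measurableW; exact: open_measurable_row.
pose F : mT -> \bar R := (EFin \o f) \_ Omega.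
have F0 x : (0 <= F x)%E by apply: erestrict_ge0 => y Oy; rewrite lee_fin f0.
have mF : measurable_fun [set: mT] F.
  by apply/(measurable_restrictT _ mO); exact: (measurable_int lambda).
pose nu : {measure set mT -> \bar R} := density lambda F F0 mF.
have nuE (A : set mT) : A `<=` Omega -> nu A = (\int[lambda]_(x in A) (f x)%:E)%E.
  move=> AO; apply: eq_integral => x; rewrite inE => Ax.
  by rewrite /F patchT// inE; exact: AO.
have nu_null (A : set mT) : measurable A -> lambda A = 0%E -> nu A = 0%E.
  by move=> mA A0; apply: null_set_integral => //; exact: measurable_funTS.
pose g i s (x : mT) := phi kappa (Y i) s x.
have mg i s : measurable_fun (Omega : set mT) (g i s).
  move=> _ B mB; apply: measurableI => //.
  apply: (lebesgue_measurableW (phi kappa (Y i) s @^-1` B)).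
  by rewrite -[X in measurable X]setTI; exact: measurable_phi.
have g_anti i s t x : s < t -> g i t x < g i s x by exact: phi_anti.
have g_lip i s t x : s <= t -> g i s x <= g i t x + (kappa - 1)^-1 * (t - s).
  exact: phi_lip.
have tie i j s t : i != j -> 0 < s -> 0 < t ->
    nu (Omega `&` [set x | g i s x = g j t x]) = 0%E.
  move=> ij s0 t_gt0; have Yij : Y i != Y j by rewrite (inj_eq injY).
  have mA : measurable ([set x | g i s x = g j t x] : set mT).
    exact: lebesgue_measurableW (measurable_phi_tie _ _ _ _ _ _).
  have le : (nu (Omega `&` [set x | g i s x = g j t x]) <=
      nu [set x | g i s x = g j t x])%E.
    by apply: le_measure; rewrite ?inE//; exact: measurableI.
  apply/le_anti; rewrite measure_ge0 andbT (le_trans le)// nu_null//.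
  exact: lebesgue_phi_tie.
have nuO : nu Omega = (\sum_i a i)%:E by rewrite nuE.
have k0 : 0 < (kappa - 1)^-1 by rewrite invr_gt0 subr_gt0.
have beta0 : delta <= beta.
  rewrite (le_trans (ltW (psi_lt kappa Delta (s2 - w) hDelta)))//.
  by rewrite /beta -psi_scaledE// ler_pM2l ?subr_gt0// -/s2; lra.
(* Dominance over the sheet of [p] is known for [b < delta] only, so [delta / 2] serves as lower
   bound [lo]; [delta <= b i] is recovered afterwards. *)
have d20 : 0 < delta / 2 by rewrite divr_gt0.
have d2 : delta / 2 < delta by lra.
have [b [bp b0 nub]] := semidiscrete_exists _ _ _ nu Omega N g a _ mO mg g_anti g_lip
  k0 tie nuO a0 p beta (delta / 2)
  (fun i => (kappa - 1) * ((Y i).2 - (Y p).2 + s1) + 1) (lt_le_trans delta0 beta0) d20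
  (fun i x _ Ox => phi_beta_lt_of_lt_delta w kappa Delta tau1 Omega N Y
    hkappa slab dist p i _ x Ox d2)
  (fun i x _ Ox => phi_lt_beta_of_gt kappa Delta tau1 Omega N Y
    hkappa dist p i _ x Ox (ltr_pwDr ltr01 (lexx _))).
pose u := envelope kappa N Y b p.
(* The cell has mass [a i > 0], while the points on the axis of [Y i] form a null set. *)
have cell_ex i : exists2 x, cell Omega g b i x & enorm (x - (Y i).1) != 0.
  apply: contrapT => no; have [mA A0] := lebesgue_row_enorm0 j0 (Y i).1.
  have := a0 i; rewrite -lte_fin -nub ltNge => /negP; apply.
  apply: (@le_trans _ _ (nu [set x | enorm (x - (Y i).1) = 0])); last first.
    by rewrite nu_null//; exact: lebesgue_measurableW.
  apply: le_measure; rewrite ?inE.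
  - exact: measurable_cell.
  - exact: lebesgue_measurableW.
  - by move=> x Cx; apply: contrapT => xY; apply: no; exists x => //; exact/eqP.
(* Otherwise the sheet of [Y i] would lie above that of [Y p] on all of [Omega], although the cell
   of [p] is nonempty. *)
have b_ge i : delta <= b i.
  rewrite leNgt; apply/negP => bd; have [x [Ox hx] _] := cell_ex p.
  have := hx i; rewrite /g bp leNgt => /negP; apply.
  exact: (phi_beta_lt_of_lt_delta w kappa Delta tau1 Omega N Y).
have uE i x : cell Omega g b i x -> u x = phi kappa (Y i) (b i) x by exact: envelope_cell.
have le_u i x : phi kappa (Y i) (b i) x <= u x by exact: phi_le_envelope.
have tracingE i : tracing kappa Omega u (Y i) = cell Omega g b i.
  by apply: tracing_envelope => //; have [x Cx _] := cell_ex i; exists x.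
have u_gt0 x : Omega x -> 0 < u x.
  move=> Ox; apply: lt_le_trans (le_u p x); rewrite bp.
  exact: (phi_beta_gt0 w kappa Delta tau1 Omega N Y).
exists u; split.
- move=> x Ox; rewrite (ltW (u_gt0 x Ox))/=.
  have [i /uE ->] := cell_cover Omega g b x p Ox.
  exact: phi_le_tau0.
- split=> // [_ [i _ <-]|x Ox].
    by have /andP[? _] := slab i; exact: lt_le_trans tau1_gt _.
  have [i Cx] := cell_cover Omega g b x p Ox.
  exists (Y i), (b i); split; [by exists i| |by move=> y _; exact: le_u|exact: uE].
  (* The bound on [b i] is read off at an off-axis point of the cell, not at the given touching
     point [x], which may lie on the axis. *)
  apply/andP; split=> //; have [y [Oy hy] yY] := cell_ex i.
  have := hy p; rewrite /g bp.
  exact: (phi_ge_beta_lt_psi w kappa Delta tau1 Omega N Y).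
- move=> E ES TE.
  have TEE : TE = \bigcup_(i in [set i | `[< E (Y i) >]]) cell Omega g b i.
    apply/seteqP; split=> x [].
      move=> y Ey; have [i _ yE] := ES _ Ey; rewrite -yE tracingE => Cx.
      by exists i => //=; apply/asboolP; rewrite yE.
    by move=> i /= /asboolP EYi Cx; exists (Y i) => //; rewrite tracingE.
  split.
    rewrite /lebesgue_measurable TEE; apply: fin_bigcup_measurable => [|i _].
      exact: (sub_finite_set (@subsetT _ _)).
    exact: measurable_cell.
  rewrite -nuE; last by rewrite TEE => x [i _ []].
  rewrite TEE nu_bigcup_cell// /mu big_mkcond; apply: eq_bigr => i _.
  rewrite diracE; case: asboolP => [EYi|nEYi].
    by rewrite mem_set// mule1.
  by rewrite memNset// mule0.
Qed.
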